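(* Let $F=F(N,\mathcal D)$ be a connected GSC with no cut points. Then $F$ has a local cut point if and only if there exist $n\in\{1,2\}$ and disjoint subsets $I,J\subset\mathcal D^n$ such that (1) $\big(\bigcup_{\mathbf i\in I}\varphi_{\mathbf i}(F)\big)\cap\big(\bigcup_{\mathbf i\in J}\varphi_{\mathbf i}(F)\big)$ is a singleton $\{x\}$, and (2) $I\cup J=\{\mathbf i\in\mathcal D^n: x\in\varphi_{\mathbf i}(F)\}$.
   Context: GSC: $N\ge2$, $\mathcal D\subset\{0,\dots,N-1\}^2$ with $1<|\mathcal D|<N^2$, $\varphi_i(x)=\frac1N(x+i)$, $F=F(N,\mathcal D)$ the unique nonempty compact set with $F=\bigcup_{i\in\mathcal D}\varphi_i(F)$; for a word $\mathbf i=i_1\cdots i_n\in\mathcal D^n$, $\varphi_{\mathbf i}=\varphi_{i_1}\circ\cdots\circ\varphi_{i_n}$. A cut point of a connected space $X$ is $x$ with $X\setminus\{x\}$ disconnected; a local cut point of $X$ is a point $x$ that is a cut point of some connected neighborhood of $x$ in $X$. *)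

(* Defs.v *)
From HB Require Import structures.
From mathcomp Require Import all_boot all_order all_algebra.
From mathcomp Require Import all_classical all_reals all_analysis.
Set Implicit Arguments. Unset Strict Implicit. Unset Printing Implicit Defensive.
Import Order.TTheory GRing.Theory Num.Theory.
Import numFieldNormedType.Exports.
Local Open Scope classical_set_scope.
Local Open Scope ring_scope.

Definition digit (N : nat) := ('I_N * 'I_N)%type.

Definition phi {R : realType} (N : nat) (i : digit N) (p : R * R) : R * R :=
  ((p.1 + (nat_of_ord i.1)%:R) / N%:R, (p.2 + (nat_of_ord i.2)%:R) / N%:R).

Definition phiw {R : realType} (N : nat) (w : seq (digit N)) : R * R -> R * R :=
  foldr (fun i f => phi i \o f) id w.

Definition word_in (N : nat) (D : {set digit N}) (w : seq (digit N)) : bool :=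
  all (fun i => i \in D) w.

Definition cut_point {T : topologicalType} (X : set T) (x : T) : Prop :=
  X x /\ ~ connected (X `\ x).

Definition nbhs_in {T : topologicalType} (X U : set T) (x : T) : Prop :=
  U `<=` X /\ exists2 O : set T, open O /\ O x & O `&` X `<=` U.

Definition local_cut_point {T : topologicalType} (X : set T) (x : T) : Prop :=
  X x /\ exists U : set T, nbhs_in X U x /\ connected U /\ cut_point U x.

Definition is_GSC_attractor {R : realType} (N : nat) (D : {set digit N})
  (F : set (R * R)) : Prop :=
  F !=set0 /\ compact F /\ F = \bigcup_(i in [set i | i \in D]) (phi i @` F).

(* Main.v *)
Require Import Defs.
From HB Require Import structures.
From mathcomp Require Import all_boot all_order all_algebra.
From mathcomp Require Import all_classical all_reals all_analysis.
From mathcomp Require Import lra.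
Set Implicit Arguments. Unset Strict Implicit.
Unset Printing Implicit Defensive.
Import Order.TTheory GRing.Theory Num.Theory.
Import numFieldNormedType.Exports.
Local Open Scope classical_set_scope.
Local Open Scope ring_scope.

(* Describe the level-n cells of F at a point x by the set T n x of positions of
   x relative to these cells. Since the intersection of two cells depends only
   on their relative position, the right-hand side for (n, x) says exactly that
   T n x splits into two nonempty parts such that every cell of one part meets
   every cell of the other one only at x. Without cut points, a cell minus x is
   connected, so a local cut point splits T m x for every large m. In a minimal
   pair (m, x) we have m <= 2: if T 1 x = {p}, then T m x = T (m-1) p;
   if T 1 x or T 2 x consists of corners of the unit square, then T stays
   constant from there on; otherwise x lies inside the common edge of two
   adjacent first-level cells, and dropping the second letter of its addresses
   gives x' with T m x = T (m-1) x'. *)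

(** * Coordinates of points and maps *)

(** A boolean indexes the axes, so that one argument serves both and [~~ b] is the axis other than
    [b]. *)
Definition pcoord {R : realType} (b : bool) (p : R * R) : R :=
  if b then p.1 else p.2.

Lemma pcoord_inj {R : realType} (p q : R * R) :
  (forall b, pcoord b p = pcoord b q) -> p = q.
Proof.
by case: p q => [p1 p2] [q1 q2] e; have /= -> := e true; have /= -> := e false.
Qed.

Lemma eq_or_eq_negb (b c : bool) : c = b \/ c = ~~ b.
Proof. by case: b c => -[]; [left|right|right|left]. Qed.

Lemma pcoord_injN {R : realType} (b : bool) (p q : R * R) :
  pcoord b p = pcoord b q -> pcoord (~~ b) p = pcoord (~~ b) q -> p = q.
Proof. by move=> e1 e2; apply: pcoord_inj; case: b e1 e2 => ? ? []. Qed.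

Definition digit_coord (N : nat) (b : bool) (i : digit N) : nat :=
  if b then i.1 else i.2.

Lemma digit_coord_lt {N : nat} (b : bool) (i : digit N) :
  (digit_coord b i < N)%N.
Proof. by rewrite /digit_coord; case: b; exact: ltn_ord. Qed.

Lemma pcoord_phi {R : realType} {N : nat} (b : bool) (i : digit N) (p : R * R) :
  pcoord b (phi i p) = (pcoord b p + (digit_coord b i)%:R) / N%:R.
Proof. by case: b. Qed.

Lemma phiw_cat {R : realType} {N : nat} (u v : seq (digit N)) (p : R * R) :
  phiw (u ++ v) p = phiw u (phiw v p).
Proof. by elim: u => //= i u IH; rewrite IH. Qed.

Lemma pcoord_phiw_sub {R : realType} {N : nat} (b : bool) (w : seq (digit N))
    (p q : R * R) :
  pcoord b (phiw w p) - pcoord b (phiw w q)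
  = (pcoord b p - pcoord b q) / N%:R ^+ size w.
Proof.
elim: w => [|i w IH] /=; first by rewrite expr0 divr1.
rewrite !pcoord_phi -mulrBl opprD addrACA subrr addr0 IH exprS invfM.
by rewrite mulrA mulrAC.
Qed.

Lemma pcoord_continuous {R : realType} (b : bool) : continuous (@pcoord R b).
Proof. by case: b => x; [exact: cvg_fst|exact: cvg_snd]. Qed.

Lemma continuous_pcoordP {R : realType} (U : topologicalType) (f : U -> R * R) :
  (forall b, continuous (pcoord b \o f)) -> continuous f.
Proof.
move=> cf x.
rewrite (_ : f = fun y => ((pcoord true \o f) y, (pcoord false \o f) y)).
  exact: (cvg_pair (cf true x) (cf false x)).
by apply/funext => y /=; case: (f y).
Qed.

Lemma phi_continuous {R : realType} {N : nat} (i : digit N) :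
  continuous (@phi R N i).
Proof.
apply: continuous_pcoordP => b x.
rewrite (_ : _ \o _ =
    fun y => (pcoord b y + (digit_coord b i)%:R) / N%:R); last first.
  by apply/funext => y /=; rewrite pcoord_phi.
apply: cvgMr_tmp; apply: cvgD; last exact: cvg_cst.
exact: pcoord_continuous.
Qed.

Lemma phiw_continuous {R : realType} {N : nat} (w : seq (digit N)) :
  continuous (@phiw R N w).
Proof.
elim: w => [|i w IH] x /=; first exact: cvg_id.
by apply: continuous_comp; [exact: IH|exact: phi_continuous].
Qed.

(* [local_points D F n x] is the set of [N^n x - a], where [(F + a) / N^n] runs
   over the level-[n] cells containing [x]: the positions of [x] relative to
   these cells. *)
Definition local_points {R : realType} {N : nat} (D : {set digit N})
    (F : set (R * R)) (n : nat) (x : R * R) : set (R * R) :=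
  [set p | F p /\
    exists w : seq (digit N), [/\ size w = n, word_in D w & phiw w p = x]].

Definition on_boundary {R : realType} (b : bool) (p : R * R) : Prop :=
  pcoord b p = 0 \/ pcoord b p = 1.

Definition corner {R : realType} (p : R * R) : Prop :=
  forall b, on_boundary b p.

(** Around [x], the cells in which it has positions [p] and [q] are copies of [F - p] and [F - q],
    scaled by the same factor, which cancels. The equation says that [a] and [c] give the same point
    of the two cells, and [a = p] says that this point is [x]. *)
Definition splits {R : realType} (F T : set (R * R)) : Prop :=
  exists P : set (R * R), [/\ T `&` P !=set0, T `\` P !=set0 &
    forall p q a c, T p -> P p -> T q -> ~ P q -> F a -> F c ->
      (forall b, pcoord b a - pcoord b p = pcoord b c - pcoord b q) -> a = p].

(** * Basic facts on the attractor *)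

Section carpet.
Variables (R : realType) (N : nat) (D : {set digit N}) (F : set (R * R)).
Hypothesis N2 : (2 <= N)%N.
Hypothesis attrF : is_GSC_attractor D F.

Let N_gt0 : 0 < N%:R :> R. Proof. by rewrite ltr0n ltnW. Qed.
Let N_neq0 : N%:R != 0 :> R. Proof. exact: lt0r_neq0. Qed.
Let T := local_points D F.

Lemma attractor_decomp (x : R * R) :
  F x -> exists i p, [/\ i \in D, F p & phi i p = x].
Proof.
have [_ [_ FE]] := attrF.
by rewrite {1}FE => -[i /= iD [p Fp <-]]; exists i, p.
Qed.

Lemma attractor_phi (i : digit N) (p : R * R) : i \in D -> F p -> F (phi i p).
Proof.
have [_ [_ FE]] := attrF.
by move=> iD Fp; rewrite FE; exists i => //; exists p.
Qed.

Lemma attractor_phiw (w : seq (digit N)) (p : R * R) :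
  word_in D w -> F p -> F (phiw w p).
Proof.
by elim: w => //= i w IH /andP[iD wD] Fp; apply: attractor_phi => //; exact: IH.
Qed.

Lemma attractor_phiw_decomp (n : nat) (x : R * R) : F x ->
  exists (w : n.-tuple (digit N)) (p : R * R),
    [/\ word_in D w, F p & phiw w p = x].
Proof.
elim: n x => [|n IH] x Fx; first by exists [tuple], x.
have [i [p [iD Fp <-]]] := attractor_decomp Fx.
have [w [q [wD Fq <-]]] := IH _ Fp.
by exists [tuple of i :: w], q; split => //=; rewrite iD.
Qed.

Lemma phiw_inj (w : seq (digit N)) : injective (@phiw R N w).
Proof.
move=> p q e; apply: pcoord_inj => b; apply/eqP; rewrite -subr_eq0.
have := pcoord_phiw_sub b w p q; rewrite e subrr => /esym/eqP.
by rewrite mulf_eq0 invr_eq0 expf_eq0 (negbTE N_neq0) andbF orbF.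
Qed.

(** Extremal argument: a minimum [m] satisfies [N m = q + i] with [q >= m] and [i >= 0], so
    [(N - 1) m >= 0]; a maximum [M] satisfies [N M <= M + N - 1], so [M <= 1]. *)
Lemma attractor_coord_bounds (b : bool) (p : R * R) :
  F p -> 0 <= pcoord b p <= 1.
Proof.
have [F0 [cF _]] := attrF => Fp.
have cc : {within F, continuous (pcoord b)}.
  exact/continuous_subspaceT/pcoord_continuous.
have N1 : 2%:R <= N%:R :> R by rewrite ler_nat.
have [M] := compact_EVT_max F0 cF cc; rewrite inE => FM maxM.
have [m] := compact_EVT_min F0 cF cc; rewrite inE => Fm minm.
apply/andP; split.
  apply: (le_trans _ (minm p (mem_set Fp))).
  have [i [q [_ Fq e]]] := attractor_decomp Fm.
  have mq := minm q (mem_set Fq).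
  have em : pcoord b m * N%:R = pcoord b q + (digit_coord b i)%:R.
    by rewrite -e pcoord_phi divfK.
  have i0 := ler0n R (digit_coord b i).
  rewrite leNgt; apply/negP => m0.
  have : 0 < - pcoord b m * (N%:R - 1) by apply: mulr_gt0; lra.
  by rewrite mulNr mulrBr mulr1; lra.
apply: (le_trans (maxM p (mem_set Fp))).
have [i [q [_ Fq e]]] := attractor_decomp FM.
have Mq := maxM q (mem_set Fq).
have eM : pcoord b M * N%:R = pcoord b q + (digit_coord b i)%:R.
  by rewrite -e pcoord_phi divfK.
have : (digit_coord b i).+1%:R <= N%:R :> R by rewrite ler_nat digit_coord_lt.
rewrite -natr1 => iN.
rewrite leNgt; apply/negP => M1.
have : 0 < (pcoord b M - 1) * (N%:R - 1) by apply: mulr_gt0; lra.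
by rewrite mulrBl mulrBr; lra.
Qed.

(** * Positions of a point relative to the cells *)

Lemma local_points_attractor (n : nat) (x p : R * R) : T n x p -> F p.
Proof. by case. Qed.

Lemma local_points_nonempty (n : nat) (x : R * R) : F x -> T n x !=set0.
Proof.
move=> Fx; have [w [p [wD Fp e]]] := attractor_phiw_decomp n Fx.
by exists p; split => //; exists w; rewrite size_tuple.
Qed.

Lemma local_points_add (n k : nat) (x q : R * R) :
  T (n + k) x q <-> exists2 p, T n x p & T k p q.
Proof.
split=> [[Fq [w [sw wD e]]]|[p [Fp [u [su uD e]]] [Fq [v [sv vD e']]]]].
  move: wD; rewrite -(cat_take_drop n w) /word_in all_cat => /andP[uD vD].
  have sz : size (take n w) = n by rewrite size_takel // sw leq_addr.
  exists (phiw (drop n w) q).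
    split; first exact: attractor_phiw.
    by exists (take n w); rewrite -phiw_cat cat_take_drop.
  by split => //; exists (drop n w); rewrite size_drop sw addKn.
split => //; exists (u ++ v).
rewrite size_cat su sv phiw_cat e'; split => //.
by rewrite /word_in all_cat; apply/andP.
Qed.

Lemma local_points1 (x p : R * R) :
  T 1 x p <-> F p /\ exists2 i, i \in D & phi i p = x.
Proof.
split=> [[Fp [[|i [|j w]] [//= _]]]|[Fp [i iD e]]].
  by rewrite andbT => iD e; split => //; exists i.
by split => //; exists [:: i]; rewrite /= iD.
Qed.

Lemma local_points0 (x : R * R) : F x -> T 0 x = [set x].
Proof.
move=> Fx; apply/seteqP; split=> [p [Fp [w [/size0nil -> _ <-]]]//|_ ->].
by split => //; exists [::].
Qed.

Lemma pcoord_local1 (b : bool) (x p : R * R) : T 1 x p ->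
  exists2 k, (k < N)%N & N%:R * pcoord b x = pcoord b p + k%:R.
Proof.
case/local_points1 => _ [i iD <-]; exists (digit_coord b i).
  exact: digit_coord_lt.
by rewrite pcoord_phi mulrC divfK.
Qed.

(** In coordinate [b], [N x = p + i = q + j] with [p] and [q] in the unit interval; if the integers
    [i] and [j] differ, they are neighbours and [p], [q] are opposite endpoints. Two points [x] and
    [y] are allowed because the reduction also compares positions of distinct points with one common
    coordinate. *)
Lemma pcoord_local1_cases (b : bool) (x y p q : R * R) :
  pcoord b x = pcoord b y -> T 1 x p -> T 1 y q ->
  pcoord b p = pcoord b q \/ on_boundary b p /\ on_boundary b q.
Proof.
move=> exy Tp Tq.
have /andP[p0 p1] := attractor_coord_bounds b (local_points_attractor Tp).
have /andP[q0 q1] := attractor_coord_bounds b (local_points_attractor Tq).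
have [i _ ei] := pcoord_local1 b Tp.
have [j _ ej] := pcoord_local1 b Tq.
rewrite exy ej in ei.
rewrite /on_boundary; case: (ltngtP i j) => [ij|ij|eij].
- have : i.+1%:R <= j%:R :> R by rewrite ler_nat.
  by rewrite -natr1 => ?; right; split; [right|left]; lra.
- have : j.+1%:R <= i%:R :> R by rewrite ler_nat.
  by rewrite -natr1 => ?; right; split; [left|right]; lra.
- by left; rewrite eij in ei; lra.
Qed.

(** In [N x = p + k] with [p] in the unit interval and [k < N], [x = 0] forces [k = 0] and [x = 1]
    forces [k = N - 1]. *)
Lemma pcoord_local1_boundary (b : bool) (x p : R * R) :
  on_boundary b x -> T 1 x p -> pcoord b p = pcoord b x.
Proof.
move=> bx Tp.
have /andP[p0 p1] := attractor_coord_bounds b (local_points_attractor Tp).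
have [i iN] := pcoord_local1 b Tp.
case: bx => ->; first by have := ler0n R i; lra.
have : i.+1%:R <= N%:R :> R by rewrite ler_nat.
by rewrite -natr1; lra.
Qed.

Lemma local_points_corner (n : nat) (x : R * R) :
  F x -> corner x -> T n x = [set x].
Proof.
move=> Fx cx; elim: n => [|n IH]; first exact: local_points0.
have T1x p : T 1 x p -> p = x.
  by move=> Tp; apply: pcoord_inj => b; exact: pcoord_local1_boundary.
rewrite -add1n; apply/seteqP; split=> [p /local_points_add[q /T1x ->]|_ ->].
  by rewrite -/(T n x) IH.
have [p Tp] := local_points_nonempty 1 Fx.
by apply/local_points_add; exists x; rewrite -?/(T n x) ?IH // -{2}(T1x p Tp).
Qed.

Lemma local_points_stable (n k : nat) (x : R * R) :
  T n x `<=` corner -> T (n + k) x = T n x.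
Proof.
move=> cT.
have Tk p : T n x p -> T k p = [set p].
  move=> Tp; apply: local_points_corner; last exact: cT.
  exact: local_points_attractor Tp.
apply/seteqP; split=> [q /local_points_add[p Tp]|q Tq].
  by rewrite -/(T k p) Tk // => ->.
by apply/local_points_add; exists q; rewrite // -/(T k q) Tk.
Qed.

(** Being off the boundary, the coordinate [~~ b] is common to all positions; coordinate [b] is
    always 0 or 1 because it is 0 at [p]. *)
Lemma local_points1_edge (b : bool) (x p q : R * R) :
  T 1 x p -> T 1 x q -> pcoord b p = 0 -> pcoord b q = 1 ->
  ~ on_boundary (~~ b) p -> T 1 x = [set p; q].
Proof.
move=> Tp Tq p0 q1 nbp; apply/seteqP; split=> [r Tr|_ [->|->]//].
have same s : T 1 x s -> pcoord (~~ b) s = pcoord (~~ b) p.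
  move=> Ts.
  by case: (pcoord_local1_cases (erefl (pcoord (~~ b) x)) Ts Tp) => [|[]].
have : on_boundary b r.
  case: (pcoord_local1_cases (erefl (pcoord b x)) Tr Tp) => [e|[]//].
  by left; rewrite e.
case=> [r0|r1]; [left|right]; apply: (@pcoord_injN _ b).
- by rewrite r0 p0.
- exact: same.
- by rewrite r1 q1.
- by rewrite same // same.
Qed.

(** * Reduction to levels one and two *)

Lemma splits_reduction (m : nat) (x : R * R) : F x -> splits F (T m x) ->
  exists n x', [/\ n = 1%N \/ n = 2%N, F x' & splits F (T n x')].
Proof.
elim/ltn_ind: m x => -[_ x Fx|[|[|m]] IH x Fx sT].
- rewrite local_points0 // => -[P [[_ [-> Px]] [_ [-> nPx]]]].
  by case: nPx.
- by exists 1%N, x; split; [left|..].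
- by exists 2%N, x; split; [right|..].
have [p Tp] := local_points_nonempty 1 Fx.
have [Tsub|] := pselect (T 1 x `<=` [set p]).
  apply: (IH m.+2 _ p); [by []|exact: local_points_attractor Tp|].
  suff <- : T (1 + m.+2) x = T m.+2 p by [].
  apply/seteqP; split=> q; first by case/local_points_add => _ /Tsub ->.
  by move=> Tq; apply/local_points_add; exists p.
move=> /existsNP[q /not_implyP[Tq qp]].
have [b pqb] : exists b, pcoord b p <> pcoord b q.
  by apply/existsNP => e; apply: qp; rewrite /= (pcoord_inj e).
(* Positions that differ in coordinate [b] have the values 0 and 1 there, up to exchanging [p] and
   [q]. *)
wlog [p0 q1] : p q Tp Tq {qp} pqb / pcoord b p = 0 /\ pcoord b q = 1.
  move=> wl; case: (pcoord_local1_cases (erefl (pcoord b x)) Tp Tq) => //.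
  case=> -[ep|ep] -[eq|eq].
  - by case: pqb; rewrite ep eq.
  - exact: (wl p q).
  - by apply: (wl q p) => //; apply: nesym.
  - by case: pqb; rewrite ep eq.
(* If so, [x] is a vertex of the first-level grid and all its positions are corners. *)
have [bp|nbp] := pselect (on_boundary (~~ b) p).
  exists 1%N, x; split=> //; first by left.
  suff <- : T (1 + m.+2) x = T 1 x by [].
  apply: local_points_stable => r Tr c.
  have [->|->] := eq_or_eq_negb b c.
    case: (pcoord_local1_cases (erefl (pcoord b x)) Tr Tp) => [e|[]//].
    by left; rewrite e.
  case: (pcoord_local1_cases (erefl (pcoord (~~ b) x)) Tr Tp) => [e|[]//].
  by rewrite /on_boundary e.
have T1E := local_points1_edge Tp Tq p0 q1 nbp.
have epq : pcoord (~~ b) p = pcoord (~~ b) q.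
  by case: (pcoord_local1_cases (erefl (pcoord (~~ b) x)) Tp Tq) => [|[]].
have T2E r : T 2 x r <-> T 1 p r \/ T 1 q r.
  rewrite -[2%N]/(1 + 1)%N local_points_add -/(T 1 x) T1E.
  split=> [[_ [->|->]]|[]]; [by left|by right| |].
    by exists p => //; left.
  by exists q => //; right.
have Fp := local_points_attractor Tp; have Fq := local_points_attractor Tq.
have [p' Tp'] := local_points_nonempty 1 Fp.
have [q' Tq'] := local_points_nonempty 1 Fq.
have p'0 : pcoord b p' = 0.
  by rewrite (pcoord_local1_boundary _ Tp') //; left.
have q'1 : pcoord b q' = 1.
  by rewrite (pcoord_local1_boundary _ Tq') //; right.
have T2b r : T 2 x r -> pcoord b r = 0 \/ pcoord b r = 1.
  case/T2E => Tr; [left|right]; rewrite (pcoord_local1_boundary _ Tr) //;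
  by [left|right].
have T2c r : T 2 x r -> pcoord (~~ b) r = pcoord (~~ b) p' \/
    on_boundary (~~ b) r /\ on_boundary (~~ b) p'.
  case/T2E => Tr; first exact: pcoord_local1_cases Tr Tp'.
  exact: pcoord_local1_cases (esym epq) Tr Tp'.
(* If so, [x] is a vertex of the second-level grid. *)
have [bp'|nbp'] := pselect (on_boundary (~~ b) p').
  exists 2%N, x; split=> //; first by right.
  suff <- : T (2 + m.+1) x = T 2 x by [].
  apply: local_points_stable => r Tr c.
  have [->|->] := eq_or_eq_negb b c.
    exact: T2b.
  by case: (T2c _ Tr) => [e|[]//]; rewrite /on_boundary e.
have epq' : pcoord (~~ b) q' = pcoord (~~ b) p'.
  by case: (T2c q' _) => [|//|[]//]; apply/T2E; right.
have /local_points1[_ [i iD ei]] := Tp; have /local_points1[_ [j jD ej]] := Tq.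
have Fp' := local_points_attractor Tp'; have Fq' := local_points_attractor Tq'.
(* Deletes the second letter from the addresses of [x]. *)
pose x' := phi i p'.
(* This follows from [phi i p = phi j q]. On axis [b], [p'] and [q'] have the same coordinates as
   [p] and [q]. On the other axis the digits of [i] and [j] agree because [p] and [q] do, and [p']
   and [q'] agree too. *)
have ex' : phi j q' = x'.
  apply: (@pcoord_injN _ b); rewrite /x' !pcoord_phi.
    have := congr1 (pcoord b) (etrans ei (esym ej)).
    by rewrite !pcoord_phi p0 q1 p'0 q'1 => ->.
  have := congr1 (pcoord (~~ b)) (etrans ei (esym ej)).
  rewrite !pcoord_phi => /(mulIf _); rewrite invr_eq0 => /(_ N_neq0).
  by rewrite epq => /addrI ->; rewrite epq'.
have Tp'' : T 1 x' p' by apply/local_points1; split=> //; exists i.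
have Tq'' : T 1 x' q' by apply/local_points1; split=> //; exists j.
have T1E' := local_points1_edge Tp'' Tq'' p'0 q'1 nbp'.
have T2E' : T 2 x = T 1 x'.
  rewrite T1E'; apply/seteqP; split=> [r Tr|_ [->|->]].
  - have e : pcoord (~~ b) r = pcoord (~~ b) p' by case: (T2c r Tr) => [|[]].
    case: (T2b r Tr) => e'; [left|right]; apply: (@pcoord_injN _ b) => //=.
    + by rewrite p'0.
    + by rewrite q'1.
    + by rewrite epq'.
  - by apply/T2E; left.
  - by apply/T2E; right.
apply: (IH m.+2 _ x') => //; first exact: attractor_phi.
suff <- : T (2 + m.+1) x = T (1 + m.+1) x' by [].
apply/seteqP; split=> r /local_points_add[s].
  by rewrite -/(T 2 x) T2E' => ? ?; apply/local_points_add; exists s.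
by rewrite -/(T 1 x') -T2E' => ? ?; apply/local_points_add; exists s.
Qed.

(** * Topology of the cells *)

(** If [F] were one point, two distinct maps would agree there, which forces equal digits. *)
Lemma attractor_nontrivial (p : R * R) : (1 < #|D|)%N -> F `\ p !=set0.
Proof.
case/card_gt1P => i [j [iD jD /eqP ij]].
apply/set0P/negP => /eqP Fp.
have FE q : F q -> q = p.
  by move=> Fq; apply: contrapT => qp; have : set0 q by rewrite -Fp.
have [[q Fq] _] := attrF; have qp := FE _ Fq; rewrite qp in Fq => {q qp}.
have ei := FE _ (attractor_phi iD Fq).
have ej := FE _ (attractor_phi jD Fq).
have e b : digit_coord b i = digit_coord b j.
  have := congr1 (pcoord b) (etrans ei (esym ej)).
  rewrite !pcoord_phi => /(mulIf _); rewrite invr_eq0 => /(_ N_neq0) /addrI.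
  by move/eqP; rewrite eqr_nat => /eqP.
apply: ij; rewrite (surjective_pairing i) (surjective_pairing j).
by congr pair; apply: val_inj; [exact: (e true)|exact: (e false)].
Qed.

Lemma cell_closed (w : seq (digit N)) : closed (phiw w @` F).
Proof.
apply: compact_closed; first exact: norm_hausdorff.
apply: continuous_compact; last by have [_ []] := attrF.
exact/continuous_subspaceT/phiw_continuous.
Qed.

(** The level-[n] cells that miss [x] are finitely many closed sets; [O] is the complement of their
    union. *)
Lemma nbhs_cells (n : nat) (x : R * R) : exists O : set (R * R),
  [/\ open O, O x & forall y, O y -> F y -> exists w : n.-tuple (digit N),
    [/\ word_in D w, (phiw w @` F) x & (phiw w @` F) y]].
Proof.
pose W := [set w : n.-tuple (digit N) | word_in D w /\ ~ (phiw w @` F) x].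
exists (~` \bigcup_(w in W) (phiw w @` F)); split.
- apply: closed_openC; apply: closed_bigcup => [|w _]; last exact: cell_closed.
  exact: finite_finset.
- by move=> [w [wD nw]].
- move=> y Oy Fy.
  have [w [p [wD Fp e]]] := attractor_phiw_decomp n Fy.
  exists w; split => //; last by exists p.
  apply: contrapT => nx; apply: Oy; exists w; first by split.
  by exists p.
Qed.

(** A level-[m] cell has extent at most [N^-m] in each coordinate. If [O] contains the ball of
    radius [e], any [m > 1/e] suffices, since [m < N^m]. *)
Lemma small_cells (O : set (R * R)) (x : R * R) : open O -> O x ->
  exists m, forall w : seq (digit N), size w = m -> word_in D w ->
    (phiw w @` F) x -> phiw w @` F `<=` O.
Proof.
move=> oO Ox; have /nbhs_ballP[e /= e0 eO] : nbhs x O by exact: open_nbhs_nbhs.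
pose m := Num.Def.archi_bound e^-1; exists m => w sw wD [p Fp px] _ [q Fq <-].
have Nm : e^-1 < N%:R ^+ m.
  have := archi_boundP (ltW (_ : 0 < e^-1)); rewrite invr_gt0 => /(_ e0).
  move=> /lt_le_trans; apply; rewrite -natrX ler_nat.
  by apply: ltnW; apply: ltn_expl.
have dist b : `|pcoord b x - pcoord b (phiw w q)| < e.
  rewrite -px pcoord_phiw_sub sw normrM normfV normrX (ger0_norm (ltW N_gt0)).
  have Nm0 : 0 < N%:R ^+ m :> R by exact: exprn_gt0.
  rewrite ltr_pdivrMr //; apply: (@le_lt_trans _ _ 1).
    have /andP[? ?] := attractor_coord_bounds b Fp.
    have /andP[? ?] := attractor_coord_bounds b Fq.
    by rewrite ler_norml; apply/andP; split; lra.
  by rewrite -(@ltr_pM2l _ e^-1) ?invr_gt0 // mulr1 mulKf ?lt0r_neq0.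
by apply: eO; split; rewrite -ball_normE /=;
  [exact: dist true|exact: dist false].
Qed.

(** * Splittings, partitions of words and local cut points *)

(** Words go to [I] or [J] according to whether the position of [x] in their cell lies in [P]; by
    injectivity a word determines this position. A point [y] common to two cells gives
    [a - p = c - q], both sides being [N^n (y - x)]. *)
Lemma splits_partition (n : nat) (x : R * R) : splits F (T n x) ->
  exists (I J : {set n.-tuple (digit N)}),
     [/\ (forall w, w \in I -> word_in D w),
         (forall w, w \in J -> word_in D w),
         [disjoint I & J]%B,
         (\bigcup_(w in [set w | w \in I]) (phiw w @` F)) `&`
           (\bigcup_(w in [set w | w \in J]) (phiw w @` F)) = [set x] &
         (forall w : n.-tuple (digit N),
            w \in I :|: J <-> (word_in D w /\ (phiw w @` F) x))].
Proof.
move=> [P [[p0 [Tp0 Pp0]] [q0 [Tq0 Pq0]] PT]].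
pose cell (Q : set (R * R)) := [set w : n.-tuple (digit N) |
  `[< word_in D w /\ exists p, [/\ F p, Q p & phiw w p = x] >]]%SET.
have cellP Q w : w \in cell Q <->
    word_in D w /\ exists p, [/\ F p, Q p & phiw w p = x].
  by rewrite inE; split => [/asboolP//|?]; apply/asboolP.
have cellT (Q : set (R * R)) p : T n x p -> Q p ->
    (\bigcup_(w in [set w | w \in cell Q]) (phiw w @` F)) x.
  move=> [Fp [w [/eqP sw wD e]]] Qp; exists (Tuple sw); last by exists p.
  by apply/cellP; split => //; exists p.
have Tin (w : n.-tuple (digit N)) p :
    word_in D w -> F p -> phiw w p = x -> T n x p.
  by move=> wD Fp e; split=> //; exists w; rewrite size_tuple.
exists (cell P), (cell (~` P)); split.
- by move=> w /cellP[].
- by move=> w /cellP[].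
- rewrite disjoint_subset; apply/fintype.subsetP => w /cellP[_ [p [_ Pp ep]]].
  apply/negP => /cellP[_ [q [_ nPq eq]]].
  by apply: nPq; rewrite -(phiw_inj (etrans ep (esym eq))).
- apply/seteqP; split=> [y [[v /cellP[vD [p [Fp Pp ep]]] [a Fa ea]]]|_ ->].
    move=> [w /cellP[wD [q [Fq Pq eq]]] [c Fc ec]].
    suff ap : a = p by rewrite -ea ap.
    apply: (PT p q a c) => //; [exact: Tin ep|exact: Tin eq|].
    move=> b; apply: (@mulIf _ (N%:R ^+ n)^-1).
      by rewrite invr_eq0 expf_neq0.
    have := pcoord_phiw_sub b v a p; have := pcoord_phiw_sub b w c q.
    by rewrite !size_tuple ea ep eq ec => <- <-.
  by split; [exact: cellT Pp0|exact: cellT Pq0].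
- move=> w; rewrite inE; split=> [/orP[]/cellP[wD [p [Fp _ e]]]|].
  + by split => //; exists p.
  + by split => //; exists p.
  + move=> [wD [p Fp e]]; apply/orP.
    by have [Pp|nPp] := pselect (P p); [left|right]; apply/cellP; split=> //;
      exists p.
Qed.

(* The cell of [F] in which [x] has relative position [p]. *)
Let cell (n : nat) (x p : R * R) : set (R * R) :=
  [set y | exists2 a, F a & forall b,
     pcoord b y - pcoord b x = (pcoord b a - pcoord b p) / N%:R ^+ n].

(** Words that give [x] the same position thus give the same cell, so a side can be assigned to a
    position instead of a word. *)
Lemma cell_phiw (w : seq (digit N)) (p : R * R) :
  cell (size w) (phiw w p) p = phiw w @` F.
Proof.
apply/seteqP; split=> [y [a Fa e]|_ [a Fa <-]].
  exists a => //; apply: pcoord_inj => b.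
  by apply: (addIr (- pcoord b (phiw w p))); rewrite pcoord_phiw_sub e.
by exists a => // b; exact: pcoord_phiw_sub.
Qed.

(** For large [m] the cells at [x] lie in [U]. Such a cell without [x] is the image of [F] minus a
    point, hence connected, so it lies on one side of the separation of [U] minus [x]. *)
Lemma local_cut_point_splits (x : R * R) : (1 < #|D|)%N ->
  (forall y, ~ cut_point F y) -> local_cut_point F x ->
  exists m, splits F (T m x).
Proof.
move=> D1 ncut [Fx [U [[UF [V0 [openV0 V0x] V0U]] [cU [Ux nU]]]]].
have [m mO] := small_cells openV0 V0x; exists m.
have /connectedPn[E [E0 EU sE]] := nU.
have cellE p : T m x p -> exists w : seq (digit N),
    [/\ size w = m, word_in D w, phiw w p = x & cell m x p = phiw w @` F].
  by move=> [Fp [w [sw wD <-]]]; exists w; split=> //; rewrite -sw cell_phiw.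
have cellx p : T m x p -> (cell m x p) `\ x !=set0 /\
    (cell m x p `\ x `<=` E false \/ cell m x p `\ x `<=` E true).
  move=> Tp; have Fp : F p := local_points_attractor Tp.
  have [w [sw wD e ->]] := cellE p Tp.
  have cellp : phiw w @` F `\ x = phiw w @` (F `\ p).
    apply/seteqP; split=> [_ [[a Fa <-] nx]|_ [a [Fa ap] <-]].
      by exists a => //; split => // ap; apply: nx; rewrite ap.
    split; first by exists a.
    by rewrite -e => /phiw_inj.
  split.
    rewrite cellp; have [a ?] := attractor_nontrivial p D1.
    by exists (phiw w a), a.
  apply: (connected_subset sE).
    rewrite -EU; apply: setSD => y wy; apply: V0U; split.
      by apply: (mO w) => //; exists p.
    by case: wy => a Fa <-; exact: attractor_phiw.
  rewrite cellp; apply: connected_continuous_connected.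
    by apply: contrapT => nc; exact: (ncut p (conj Fp nc)).
  exact/continuous_subspaceT/phiw_continuous.
have disj y : E false y -> E true y -> False.
  by move=> y0 y1; have /seteqP[/(_ y) + _] := separated_disjoint sE; apply.
(* If all cells at [x] were on the same side, [x] would not be in the closure of
   the other side, which would then be clopen in the connected set [U]. *)
have two_sides (E' : bool -> set (R * R)) : (forall b, E' b !=set0) ->
    U `\ x = E' false `|` E' true -> separated (E' false) (E' true) ->
    ~ (forall p, T m x p -> cell m x p `\ x `<=` E' false).
  move=> E'0 E'U sE' all0.
  have [V [oV Vx VF]] := nbhs_cells m x.
  have E'U1 y : E' true y -> U y /\ y <> x.
    by move=> y1; have : (U `\ x) y by rewrite E'U; right.
  have xE1 : ~ closure (E' true) x.
    move=> /(_ V (open_nbhs_nbhs _))[//|y [y1 Vy]].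
    have [Uy yx] := E'U1 _ y1.
    have [w [wD [p Fp e] wy]] := VF y Vy (UF _ Uy).
    have Tp : T m x p by split => //; exists w; rewrite size_tuple.
    have y0 : E' false y.
      apply: (all0 p Tp); split=> //.
      by rewrite -e -{1}(size_tuple w) cell_phiw.
    by have /seteqP[/(_ y) + _] := separated_disjoint sE'; apply.
  move: cU => /connectedP/(_ (fun b => if b then E' true else x |` E' false)).
  apply; split.
  - by case; [exact: E'0|exists x; left].
  - by rewrite -setUA -E'U setD1K.
  - case: sE' => s1 s2; split; apply/seteqP; split=> // y [].
      rewrite closureU => -[] y0 y1; last by rewrite -s1.
      have : closure [set x] y by [].
      rewrite -(closure_id _).1; last first.
        exact/accessible_closed_set1/hausdorff_accessible/norm_hausdorff.
      by move=> yx; case: (E'U1 _ y1).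
    by move=> [->//|y0 y1]; rewrite -s2.
(* The part of the positions on side [E false]. Both parts are nonempty by [two_sides], used with
   exchanged sides for the first one. *)
exists [set p | cell m x p `\ x `<=` E false]; split.
- apply: contrapT => n0.
  apply: (two_sides (E \o negb)) => [b|||p Tp] /=; first exact: E0.
  + by rewrite EU setUC.
  + by rewrite separatedC.
  + by have [_ []//] := cellx p Tp; move=> p0; case: n0; exists p.
- apply: contrapT => n0; apply: (two_sides E) => // p Tp.
  by apply: contrapT => np; apply: n0; exists p.
- move=> p q a c Tp p0 Tq nq0 Fa Fc e.
  have q1 : cell m x q `\ x `<=` E true by have [_ []] := cellx q Tq.
  have [w [sw wD ew cw]] := cellE p Tp.
  have eb b : pcoord b (phiw w a) - pcoord b x
      = (pcoord b a - pcoord b p) / N%:R ^+ m by rewrite -ew pcoord_phiw_sub sw.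
  have [ax|ax] := pselect (phiw w a = x).
    by apply: (phiw_inj (w := w)); rewrite ax ew.
  (* A common point other than [x] would lie on both sides. *)
  case: (disj (phiw w a)); [apply: p0|apply: q1]; split=> //.
    by exists a.
  by exists c => // b; rewrite eb e.
Qed.

(** The union of the level-[n] cells through [x] is a neighbourhood of [x], connected because the
    cells are connected and share [x]. Removing [x] separates the parts from [I] and [J], which are
    closed unions meeting only at [x]. *)
Lemma partition_local_cut_point (n : nat) (I J : {set n.-tuple (digit N)})
    (x : R * R) : (1 < #|D|)%N -> connected F ->
  (forall w, w \in I -> word_in D w) -> (forall w, w \in J -> word_in D w) ->
  (\bigcup_(w in [set w | w \in I]) (phiw w @` F)) `&`
    (\bigcup_(w in [set w | w \in J]) (phiw w @` F)) = [set x] ->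
  (forall w : n.-tuple (digit N),
     w \in I :|: J <-> (word_in D w /\ (phiw w @` F) x)) ->
  local_cut_point F x.
Proof.
move=> D1 cF ID JD AB IJ.
pose cells (K : {set n.-tuple (digit N)}) :=
  \bigcup_(w in [set w | w \in K]) (phiw w @` F).
have cells_sub (K : {set n.-tuple (digit N)}) :
    (forall w, w \in K -> word_in D w) -> cells K `<=` F.
  move=> KD y [w wK [p Fp <-]].
  by apply: attractor_phiw => //; exact: KD.
have cells_closed K : closed (cells K).
  by apply: closed_bigcup => [|w _]; [exact: finite_finset|exact: cell_closed].
have [xI xJ] : cells I x /\ cells J x.
  by have /seteqP[_ /(_ x erefl)] := AB.
have cells_nontrivial K : cells K x -> cells K `\ x !=set0.
  move=> [w wK [p Fp e]]; have [q [Fq qp]] := attractor_nontrivial p D1.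
  exists (phiw w q); split; first by exists w => //; exists q.
  by rewrite -e => /phiw_inj.
have IJU : cells I `|` cells J = cells (I :|: J).
  rewrite /cells -bigcup_setU; congr (\bigcup_(w in _) _).
  apply/seteqP; split=> w /=; rewrite inE.
    by case=> ->; rewrite ?orbT.
  by move/orP.
split; first exact: cells_sub xI.
exists (cells I `|` cells J); split; [split|split].
- by rewrite subUset; split; exact: cells_sub.
- have [V [openV Vx Vcells]] := nbhs_cells n x; exists V; first by split.
  move=> y [Vy Fy]; have [w [wD wx wy]] := Vcells y Vy Fy.
  by rewrite IJU; exists w => //=; apply/IJ.
- rewrite IJU; apply: bigcup_connected.
    by exists x => w /= /IJ[].
  move=> w _; apply: connected_continuous_connected => //.
  exact/continuous_subspaceT/phiw_continuous.
- split; first by left.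
  apply/connectedPn.
  exists (fun b => if b then cells J `\ x else cells I `\ x); split.
  + by case; exact: cells_nontrivial.
  + by rewrite setDUl.
  + have sub K : closure (cells K `\ x) `<=` cells K.
      rewrite [X in _ `<=` X](closure_id _).1 //.
      by apply: closureS; exact: subDsetl.
    have meet y : cells I y -> cells J y -> y = x.
      by move=> yI yJ; have /seteqP[/(_ y) + _] := AB; apply.
    split; apply/seteqP; split=> // y [].
      by move=> /sub yI [yJ]; apply; exact: meet.
    by move=> [yI yx] /sub yJ; apply: yx; exact: meet.
Qed.

End carpet.

Theorem mainTheorem2 (R : realType) (N : nat) (D : {set digit N})
  (F : set (R * R)) :
  (2 <= N)%N -> (1 < #|D|)%N -> (#|D| < N ^ 2)%N ->
  is_GSC_attractor D F ->
  connected F ->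
  (forall x, ~ cut_point F x) ->
  ((exists x, local_cut_point F x) <->
   exists n : nat, (n = 1 \/ n = 2)%N /\
   exists (I J : {set n.-tuple (digit N)}) (x : R * R),
     [/\ (forall w, w \in I -> word_in D w),
         (forall w, w \in J -> word_in D w),
         [disjoint I & J]%B,
         (\bigcup_(w in [set w | w \in I]) (phiw w @` F)) `&`
           (\bigcup_(w in [set w | w \in J]) (phiw w @` F)) = [set x] &
         (forall w : n.-tuple (digit N),
            w \in I :|: J <-> (word_in D w /\ (phiw w @` F) x))]).
Proof.
move=> N2 D1 _ attrF cF ncut; split=> [[x lx]|].
  have [m sm] := local_cut_point_splits N2 attrF D1 ncut lx.
  have Fx : F x by case: lx.
  (* The point may change from [x] to [x'], as only existence is claimed. *)
  have [n [x' [n12 _ sn]]] := splits_reduction N2 attrF Fx sm.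
  have [I [J IJ]] := splits_partition N2 sn.
  by exists n; split=> //; exists I, J, x'.
move=> [n [_ [I [J [x [ID JD _ AB IJ]]]]]]; exists x.
exact: (partition_local_cut_point N2 attrF D1 cF ID JD AB IJ).
Qed.
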